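(* Let $\mathbb{F}$ be a field. For any subspace $\mathcal{W}$ of $\mathbb{F}^{n}$, the lime indices of $\mathcal{W}^{\bullet}$ are exactly the non-red indices of $\mathcal{W}$ (that is, the indices in $\{1,\dots,n\}$ that are not red indices of $\mathcal{W}$).
   Context: $\mathbb{F}$ is an arbitrary field. For $X,Y\in\mathbb{F}^n$, $X\bullet Y=\sum_{i=1}^n X(i)Y(i)$ is the standard symmetric bilinear form (dot product), where $X(i)$ is the $i$-th entry of $X$. For $\mathcal{S}\subseteq\mathbb{F}^n$, the $\bullet$-complement is $\mathcal{S}^{\bullet}=\{X\in\mathbb{F}^{n} : X\bullet Y=0 \text{ for all } Y\in\mathcal{S}\}$. A non-zero vector terminates in the $j$-th position if its last non-zero entry is in the $j$-th position, and originates in the $j$-th position if its first non-zero entry is in the $j$-th position. For a subspace $\mathcal{W}$ of $\mathbb{F}^n$, an index $j$ is a red index of $\mathcal{W}$ if $\mathcal{W}$ contains an element that terminates in the $j$-th position, and a lime index of $\mathcal{W}$ if $\mathcal{W}$ contains an element that originates in the $j$-th position. *)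

(* Defs.v *)
From HB Require Import structures.
From mathcomp Require Import all_boot all_order all_algebra.
From mathcomp Require Import classical_sets.
Set Implicit Arguments.
Unset Strict Implicit.
Unset Printing Implicit Defensive.
Import GRing.Theory.
Local Open Scope classical_set_scope.
Local Open Scope ring_scope.

(* Vectors of F^n are row vectors; positions 1..n are represented by the
   ordinals 0..n-1, in the same order. *)

Definition dot (F : fieldType) (n : nat) (X Y : 'rV[F]_n) : F :=
  \sum_(i < n) X 0 i * Y 0 i.

Definition dot_complement (F : fieldType) (n : nat) (S : set 'rV[F]_n) :
    set 'rV[F]_n :=
  [set X | forall Y, S Y -> dot X Y = 0].

Definition terminates_at (F : fieldType) (n : nat) (X : 'rV[F]_n) (j : 'I_n)
    : Prop :=
  X 0 j != 0 /\ (forall i : 'I_n, (j < i)%N -> X 0 i = 0).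

Definition originates_at (F : fieldType) (n : nat) (X : 'rV[F]_n) (j : 'I_n)
    : Prop :=
  X 0 j != 0 /\ (forall i : 'I_n, (i < j)%N -> X 0 i = 0).

(* The index sets take the underlying set of a subspace, so that they apply
   directly to a dot_complement. *)
Definition red_indices (F : fieldType) (n : nat) (W : set 'rV[F]_n) :
    set 'I_n :=
  [set j | exists X, W X /\ terminates_at X j].

Definition lime_indices (F : fieldType) (n : nat) (W : set 'rV[F]_n) :
    set 'I_n :=
  [set j | exists X, W X /\ originates_at X j].

(* Main.v *)
Require Import Defs.
From HB Require Import structures.
From mathcomp Require Import all_boot all_order all_algebra.
From mathcomp Require Import classical_sets.
Local Open Scope classical_set_scope.
Local Open Scope ring_scope.

(** If [X] originates and [Y] terminates at the same position [j], their
    supports meet only in [j], so [dot X Y = X 0 j * Y 0 j != 0]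
    ([dot_originates_terminates]); hence a lime index of the complement of [W]
    cannot be a red index of [W].

    Conversely, let [U] be the span of the first [j] unit vectors and [e_j] the
    unit vector at [j] (counting from 0).  Duality separates a vector from a
    subspace that does not contain it: either [e_j] lies in [W + U], or some
    [X] is orthogonal to [W] and to [U] but not to [e_j].  In the first case
    [e_j = w + u], and [w = e_j - u] terminates at [j], so [j] is red.  In the
    second case, orthogonality to [U] says that [X] vanishes before [j], so
    that [X] originates at [j] and [j] is a lime index of the complement
    ([terminates_or_originates]).  The separating vector is a column of the
    cokernel matrix of [W + U]. *)

Import GRing.Theory.

Lemma dot_originates_terminates {F : fieldType} {n : nat} {X Y : 'rV[F]_n}
    {j : 'I_n} :
  originates_at X j -> terminates_at Y j -> dot X Y = X 0 j * Y 0 j.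
Proof.
move=> [_ X0] [_ Y0]; rewrite /dot (bigD1 j) //= big1 ?addr0 // => i neq_ij.
have [lt_ij | lt_ji | eq_ij] := ltngtP i j.
- by rewrite X0 ?mul0r.
- by rewrite Y0 ?mulr0.
- by case/eqP: neq_ij; apply: val_inj.
Qed.

Lemma mul_pid_mxE {F : fieldType} {m n p r : nat} (A : 'M[F]_(m, n))
    (i : 'I_m) (k : 'I_p) :
  (r <= k)%N -> (A *m (pid_mx r : 'M_(n, p))) i k = 0.
Proof.
move=> le_rk; rewrite mxE big1 // => l _; rewrite mxE.
by case: eqP => [-> | _]; rewrite ?(ltnNge k) ?le_rk /= mulr0.
Qed.

Lemma row_pid_mx {F : fieldType} {n r : nat} (i : 'I_n) :
  (i < r)%N -> row i (pid_mx r : 'M[F]_n) = delta_mx 0 i.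
Proof.
by move=> lt_ir; apply/rowP=> k; rewrite !mxE lt_ir andbT eqxx eq_sym.
Qed.

(** The matrix form of the dichotomy: [pid_mx j] has the span of the unit
    vectors before [j] as its row space, and membership in a row space is
    decided by the cokernel, whose columns are exactly the tests needed. *)
Lemma terminates_or_originates {F : fieldType} {m n : nat} (M : 'M[F]_(m, n))
    (j : 'I_n) :
  (exists a : 'rV[F]_m, terminates_at (a *m M) j) \/
  (exists2 X : 'rV[F]_n, M *m X^T = 0 & originates_at X j).
Proof.
set U : 'M[F]_n := pid_mx j.
have [/sub_addsmxP[[a b] /= def_ej] | ] :=
    boolP ((delta_mx 0 j : 'rV[F]_n) <= M + U)%MS.
  left; exists a.
  have aM (k : 'I_n) : (j <= k)%N -> (a *m M) 0 k = (k == j)%:R.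
    move=> le_jk; have := congr1 (fun A : 'rV[F]_n => A 0 k) def_ej.
    by rewrite mxE [RHS]mxE mul_pid_mxE // addr0 mxE eqxx => <-.
  split=> [|i lt_ji]; first by rewrite aM // eqxx oner_neq0.
  by rewrite aM 1?ltnW // -val_eqE /= gtn_eqF.
rewrite submxE => /rV0Pn[k]; set C := cokermx _ => ejC.
have C0 p (A : 'M[F]_(p, n)) : (A <= M + U)%MS -> A *m C = 0.
  by rewrite submxE => /eqP.
right; exists (col k C)^T.
  by rewrite trmxK colE mulmxA C0 ?addsmxSl // mul0mx.
split=> [|i lt_ij]; first by move: ejC; rewrite -rowE !mxE.
have Ui : ((delta_mx 0 i : 'rV[F]_n) <= M + U)%MS.
  by rewrite -(row_pid_mx i lt_ij) (submx_trans (row_sub _ _)) ?addsmxSr.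
by have /rowP/(_ k) := C0 _ _ Ui; rewrite -rowE !mxE.
Qed.

Theorem theorem5p1 (F : fieldType) (n : nat) (W : {vspace 'rV[F]_n}) :
  lime_indices (dot_complement [set` W]) = ~` red_indices [set` W].
Proof.
apply/seteqP; split=> j /=.
  move=> [X [XW Xj]] [Y [YW Yj]]; move: (XW Y YW) => /eqP.
  rewrite (dot_originates_terminates Xj Yj) mulf_eq0.
  by rewrite (negPf Xj.1) (negPf Yj.1).
move=> not_red; pose M := \matrix_(i < \dim W) (vbasis W)`_i.
have aME (a : 'rV_(\dim W)) : a *m M = \sum_i a 0 i *: (vbasis W)`_i.
  by rewrite mulmx_sum_row; apply: eq_bigr => i _; rewrite rowK.
have [[a aMj] | [X MX Xj]] := terminates_or_originates M j.
  case: not_red; exists (a *m M); split=> //=.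
  rewrite aME; apply: memv_suml => i _; apply/memvZ/vbasis_mem.
  by rewrite mem_nth ?size_tuple.
exists X; split=> // Y /= YW.
have -> : Y = \row_i coord (vbasis W) i Y *m M.
  by rewrite aME [LHS](coord_vbasis YW); apply: eq_bigr => i _; rewrite mxE.
set a := \row_i _.
have -> : dot X (a *m M) = (a *m M *m X^T) 0 0.
  by rewrite mxE; apply: eq_bigr => i _; rewrite [X^T _ _]mxE mulrC.
by rewrite -mulmxA MX mulmx0 mxE.
Qed.
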